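(* Let each $f_{i,j}$ be $L_f$-smooth with $\gamma>2\lambda>4L_f$, so that $\tilde f_{i,j}$ (hence $F_i$) is $L_{\tilde f}$-smooth with $L_{\tilde f}=\lambda$, and $\gamma>L_{\tilde f}$. Fix a team $i$ and $x^t\in\mathbb{R}^d$; let $w_i^{t,0}=x^t$ and $w_i^{t,k+1}=(1-\eta_i(\lambda+\gamma))w_i^{t,k}+\eta_i\gamma x^t+\eta_i\lambda\frac1{N_i}\sum_{j=1}^{N_i}\theta_{i,j}^{t,k,L}$ for $k=0,\dots,K-1$, where $\|\mathrm{prox}_{f_{i,j}/\lambda}(w_i^{t,k})-\theta_{i,j}^{t,k,L}\|^2\le\delta_{i,j}$ for all $k,j$. Let $p_i(y)=F_i(y)+\frac\gamma2\|y-x^t\|^2$ and let $w_i^{t,k^*}$ be an iterate $w_i^{t,k}$, $k\in\{0,\dots,K-1\}$, minimizing $\|\nabla p_i(w_i^{t,k})\|^2$. If $\eta_i\le\frac1{L_{\tilde f}+\gamma}$, then $$\|w_i^{t,k^*}-\mathrm{prox}_{F_i/\gamma}(x^t)\|^2\le\frac{1}{(\gamma-L_{\tilde f})^2}\Big(\frac{2}{K\eta_i}\big(F_i(x^t)-\tilde F_i(x^t)\big)+\lambda^2\frac1{N_i}\sum_{j=1}^{N_i}\delta_{i,j}\Big).$$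
   Context: Given $\lambda,\gamma>0$ and differentiable $f_{i,j}$: $\tilde f_{i,j}(w)=\min_\theta\{f_{i,j}(\theta)+\frac\lambda2\|\theta-w\|^2\}$ with minimizer $\mathrm{prox}_{f_{i,j}/\lambda}(w)$; $F_i(w)=\frac1{N_i}\sum_j\tilde f_{i,j}(w)$; $\tilde F_i(x)=\min_w\{F_i(w)+\frac\gamma2\|w-x\|^2\}$ with minimizer $\mathrm{prox}_{F_i/\gamma}(x)$. (The paper writes the first term as $F_i(x^t)-\mathrm{prox}_{F_i/\gamma}(x^t)$; the quantity meant is $p_i(x^t)-p_i(\mathrm{prox}_{F_i/\gamma}(x^t))=F_i(x^t)-\tilde F_i(x^t)$.) *)

(* Defs.v *)
From HB Require Import structures.
From mathcomp Require Import all_boot all_order all_algebra.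
From mathcomp Require Import classical_sets boolp reals.
Set Implicit Arguments.
Unset Strict Implicit.
Unset Printing Implicit Defensive.
Import Order.TTheory GRing.Theory Num.Theory.
Local Open Scope ring_scope.
Local Open Scope classical_set_scope.

Section Defs.
Variables (R : realType) (d : nat).
Notation V := 'rV[R]_d.

Definition dotv (u v : V) : R := \sum_(i < d) u 0 i * v 0 i.
Definition sqn (u : V) : R := dotv u u.
Definition enorm (u : V) : R := Num.sqrt (sqn u).

Definition is_gradient (f : V -> R) (g : V -> V) : Prop :=
  forall x e, 0 < e -> exists2 del, 0 < del &
    forall h, enorm h < del -> `|f (x + h) - f x - dotv (g x) h| <= e * enorm h.

Definition smooth (L : R) (f : V -> R) : Prop :=
  exists g, is_gradient f g /\ forall x y, enorm (g x - g y) <= L * enorm (x - y).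

Definition moreau (f : V -> R) (lam : R) (w : V) : R :=
  inf (range (fun th => f th + lam / 2 * sqn (th - w))).

Definition prox_set (f : V -> R) (lam : R) (w : V) : set V :=
  [set th | forall th', f th + lam / 2 * sqn (th - w) <= f th' + lam / 2 * sqn (th' - w)].

Definition prox (f : V -> R) (lam : R) (w : V) : V := xget 0 (prox_set f lam w).

End Defs.

(* Main.v *)
(* For weakly convex smooth [f] with [2 L <= lam], comparing the value at [y + h]
   with the quadratic model at the proximal point of [y] shows that the Moreau
   envelope lies within [lam / 2 * |h|^2] of its tangent with slope
   [lam (y - prox y)]. Averaging over [j] and adding [gam / 2 * |y - x|^2], the
   objective [p] is [(gam - lam)]-strongly convex and [(gam + lam)]-smooth, and the
   iteration is gradient descent on [p] with an error equal to [lam] times the mean of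
   [prox - theta]. Each step decreases [p] by at least
   [eta / 2 * (|grad p|^2 - |error|^2)]; telescoping bounds the smallest gradient, and
   strong convexity turns this into a bound on the distance to the minimizer. *)

Require Import Defs.
From mathcomp Require Import all_boot all_order all_algebra.
From mathcomp Require Import classical_sets boolp reals.
From mathcomp Require Import topology normedtype derive realfun.
From mathcomp Require Import ring lra.
Import Order.TTheory GRing.Theory Num.Theory.
Import numFieldTopology.Exports numFieldNormedType.Exports.
Local Open Scope ring_scope.

(** * Euclidean inner product and norm on row vectors *)

Section InnerProduct.
Set Implicit Arguments.
Unset Strict Implicit.
Context {R : realType} {d : nat}.
Implicit Types u v w : 'rV[R]_d.

Lemma dotvC u v : dotv u v = dotv v u.
Proof. by apply: eq_bigr => i _; rewrite mulrC. Qed.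

Lemma dotvDl u v w : dotv (u + v) w = dotv u w + dotv v w.
Proof. by rewrite -big_split; apply: eq_bigr => i _; rewrite mxE mulrDl. Qed.

Lemma dotvDr u v w : dotv u (v + w) = dotv u v + dotv u w.
Proof. by rewrite dotvC dotvDl !(dotvC u). Qed.

Lemma dotvZl a u v : dotv (a *: u) v = a * dotv u v.
Proof. by rewrite /dotv mulr_sumr; apply: eq_bigr => i _; rewrite mxE mulrA. Qed.

Lemma dotvZr a u v : dotv u (a *: v) = a * dotv u v.
Proof. by rewrite dotvC dotvZl dotvC. Qed.

Lemma dotvNl u v : dotv (- u) v = - dotv u v.
Proof. by rewrite -scaleN1r dotvZl mulN1r. Qed.

Lemma dotvNr u v : dotv u (- v) = - dotv u v.
Proof. by rewrite dotvC dotvNl dotvC. Qed.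

Definition dotvE := (dotvDl, dotvDr, dotvNl, dotvNr, dotvZl, dotvZr).

Lemma dotv0r u : dotv u 0 = 0.
Proof. by rewrite -(scale0r 0) dotvZr mul0r. Qed.

Lemma dotv_suml (I : Type) (r : seq I) (P : pred I) (F : I -> 'rV[R]_d) v :
  dotv (\sum_(i <- r | P i) F i) v = \sum_(i <- r | P i) dotv (F i) v.
Proof.
apply: (big_morph (fun u => dotv u v)) => [u w|]; first exact: dotvDl.
by rewrite dotvC dotv0r.
Qed.

Lemma sqn_ge0 u : 0 <= sqn u.
Proof. by apply: sumr_ge0 => i _; rewrite -expr2 sqr_ge0. Qed.

Lemma sqnN u : sqn (- u) = sqn u.
Proof. by rewrite /sqn !dotvE opprK. Qed.

Lemma sqnD u v : sqn (u + v) = sqn u + 2 * dotv u v + sqn v.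
Proof. by rewrite /sqn !dotvE (dotvC v); ring. Qed.

Lemma sqnB u v : sqn (u - v) = sqn u + - 2 * dotv u v + sqn v.
Proof. by rewrite sqnD sqnN dotvNr; ring. Qed.

Lemma sqn_eq0 u : sqn u = 0 -> u = 0.
Proof.
move=> /eqP; rewrite psumr_eq0 => [/allP u0|i _]; last by rewrite -expr2 sqr_ge0.
apply/rowP => i; rewrite mxE; apply/eqP.
by have := u0 i (mem_index_enum i); rewrite /= mulf_eq0 orbb.
Qed.

Lemma sqr_enorm u : enorm u ^+ 2 = sqn u.
Proof. by rewrite sqr_sqrtr ?sqn_ge0. Qed.

Lemma enorm_ge0 u : 0 <= enorm u.
Proof. exact: sqrtr_ge0. Qed.

Lemma sqnZ a u : sqn (a *: u) = a ^+ 2 * sqn u.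
Proof. by rewrite /sqn !dotvE mulrA expr2. Qed.

Lemma enormZ a u : enorm (a *: u) = `|a| * enorm u.
Proof. by rewrite /enorm sqnZ sqrtrM ?sqr_ge0// sqrtr_sqr. Qed.

Lemma enormN u : enorm (- u) = enorm u.
Proof. by rewrite /enorm sqnN. Qed.

Lemma sqr_coord_le u i : u 0 i ^+ 2 <= sqn u.
Proof.
rewrite /sqn /dotv (bigD1 i)//= -expr2 lerDl.
by apply: sumr_ge0 => j _; rewrite -expr2 sqr_ge0.
Qed.

Lemma dotv_young (c : R) u v : 0 < c -> dotv u v <= c / 2 * sqn u + (2 * c)^-1 * sqn v.
Proof.
move=> c0; have : 0 <= c^-1 * sqn (c *: u - v).
  by rewrite mulr_ge0 ?sqn_ge0// invr_ge0 ltW.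
have -> : (2 * c)^-1 = c^-1 / 2 by field; rewrite gt_eqF.
rewrite (_ : c^-1 * sqn _ = c * sqn u - 2 * dotv u v + c^-1 * sqn v); first by lra.
by rewrite sqnB sqnZ dotvZl; field; rewrite gt_eqF.
Qed.

Lemma dotv_le_enorm u v : dotv u v <= enorm u * enorm v.
Proof.
have [/eqP u0|u0] := boolP (enorm u == 0).
  have -> : u = 0 by apply: sqn_eq0; rewrite -sqr_enorm u0 expr0n.
  by rewrite dotvC dotv0r mulr_ge0 ?enorm_ge0.
have [/eqP v0|v0] := boolP (enorm v == 0).
  have -> : v = 0 by apply: sqn_eq0; rewrite -sqr_enorm v0 expr0n.
  by rewrite dotv0r mulr_ge0 ?enorm_ge0.
have up : 0 < enorm u by rewrite lt_def u0 enorm_ge0.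
have vp : 0 < enorm v by rewrite lt_def v0 enorm_ge0.
(* This weight makes both Young terms equal to [enorm u * enorm v / 2]. *)
have := @dotv_young (enorm v / enorm u) u v (divr_gt0 vp up).
rewrite -!sqr_enorm => /le_trans; apply; rewrite le_eqVlt; apply/orP; left.
by apply/eqP; field; rewrite u0 v0.
Qed.

(** Expanding [|v - m u|^2 >= 0] gives [|v|^2 >= 2 m <v, u> - m^2 |u|^2]. This turns strong
    monotonicity of a gradient into a distance bound. *)
Lemma sqn_le_dotv (m : R) u v : 0 < m -> m * sqn u <= dotv v u -> m ^+ 2 * sqn u <= sqn v.
Proof.
move=> m0 H; have := sqn_ge0 (v - m *: u); rewrite /sqn !dotvE (dotvC u v) => H'.
by have := ler_wpM2l (ltW m0) H; rewrite /sqn expr2; lra.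
Qed.

Lemma sqn_mean_le N (v : 'I_N -> 'rV[R]_d) : (0 < N)%N ->
  sqn (N%:R^-1 *: \sum_(j < N) v j) <= N%:R^-1 * \sum_(j < N) sqn (v j).
Proof.
move=> N0; set a := N%:R^-1 *: _.
have Na : N%:R^-1 * N%:R = 1 :> R by rewrite mulVf ?pnatr_eq0 -?lt0n.
(* The variance [mean of |v j - a|^2] is nonnegative. *)
have : 0 <= N%:R^-1 * \sum_(j < N) sqn (v j - a).
  by rewrite mulr_ge0 ?invr_ge0 ?ler0n//; apply: sumr_ge0 => j _; exact: sqn_ge0.
under eq_bigr do rewrite sqnB.
rewrite !big_split /= sumr_const card_ord -mulr_sumr -dotv_suml -[sqn a *+ N]mulr_natl.
rewrite !mulrDr [_ * (_ * sqn a)]mulrA Na mul1r (mulrCA _ (- 2)) -dotvZl -/a -/(sqn a); lra.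
Qed.

End InnerProduct.

(** * Quadratic bounds around tangents, continuity and existence of minimizers *)

Section TangentBounds.
Set Implicit Arguments.
Unset Strict Implicit.
Local Open Scope classical_set_scope.
Local Open Scope ring_scope.
Context {R : realType} {d : nat}.
Implicit Types (u v x y z h : 'rV[R]_d) (f : 'rV[R]_d -> R) (g : 'rV[R]_d -> 'rV[R]_d).

(* For [g] the gradient of [f] this says that [f] is [m]-strongly convex
   ([-m]-weakly convex when [m < 0]) and [M]-smooth from above. *)
Definition tangent_bounds (m M : R) f g := forall y h,
  dotv (g y) h + m / 2 * sqn h <= f (y + h) - f y <= dotv (g y) h + M / 2 * sqn h.

Lemma is_gradientN f g : is_gradient f g -> is_gradient (fun x => - f x) (fun x => - g x).
Proof.
move=> fg x e /(fg x)[del del0 H]; exists del => // h /H.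
by rewrite !dotvE -normrN; congr (`|_| <= _); ring.
Qed.

Lemma is_gradient_line f g x h (t : R) : is_gradient f g ->
  is_derive t 1 (fun s : R => f (x + s *: h)) (dotv (g (x + t *: h)) h).
Proof.
move=> fg.
have : (fun s : R => s^-1 *:
      (((fun s : R => f (x + s *: h)) \o shift t) (s *: 1) - f (x + t *: h)))
    @ 0^' --> dotv (g (x + t *: h)) h.
  apply/cvgrPdist_le => e e0 /=.
  (* The added 1 keeps the divisor positive when [h = 0]. *)
  have n0 : 0 < enorm h + 1 by have := enorm_ge0 h; lra.
  have [del del0 H] := fg (x + t *: h) (e / (enorm h + 1)) (divr_gt0 e0 n0).
  exists (del / (enorm h + 1)); first exact: divr_gt0.
  move=> s /=; rewrite sub0r normrN => sdel s0.
  have sp : 0 < `|s| by rewrite normr_gt0.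
  have E : x + (s *: 1 + t) *: h = x + t *: h + s *: h.
    by rewrite scalerDl /GRing.scale /= mulr1 addrA addrAC.
  rewrite E.
  have /H : enorm (s *: h) < del.
    rewrite enormZ; move: sdel; rewrite ltr_pdivlMr// => /le_lt_trans; apply.
    by rewrite ler_wpM2l ?(ltW sp)//; lra.
  rewrite enormZ dotvZr => H1.
  rewrite -(ler_pM2l sp) -normrM.
  rewrite (_ : s * _ =
      - (f (x + t *: h + s *: h) - f (x + t *: h) - s * dotv (g (x + t *: h)) h)).
    rewrite normrN; apply: (le_trans H1).
    rewrite mulrCA ler_wpM2l ?(ltW sp)// -mulrA ger_pMr// mulrC ler_pdivrMr// mul1r; lra.
  by rewrite /GRing.scale /=; field.
move=> H; apply: DeriveDef; first by apply/cvg_ex; eexists; exact: H.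
exact: cvg_lim H.
Qed.

(** Along the segment, [f] minus its quadratic model is nonincreasing. The hypothesis is one-sided
    so that the lemma can be applied to [- f] as well. *)
Lemma descent_lemma (L : R) f g : is_gradient f g ->
  (forall x y, dotv (g x - g y) (x - y) <= L * sqn (x - y)) ->
  forall y h, f (y + h) - f y <= dotv (g y) h + L / 2 * sqn h.
Proof.
move=> fg gL y h.
pose q (t : R) := f (y + t *: h) - (dotv (g y) h * t + L / 2 * sqn h * t ^+ 2).
have dq (t : R) : is_derive t 1 q (dotv (g (y + t *: h)) h - (dotv (g y) h + L * sqn h * t)).
  have := is_gradient_line y h t fg => H.
  apply: is_derive_eq.
  by rewrite /GRing.scale /=; field.
suff : q 1 <= q 0.
  by rewrite /q scale0r addr0 scale1r; lra.
apply: (@ler0_derive1_le_cc _ q 0 1) => //; rewrite ?in_itv/= ?lexx ?ler01//.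
- move=> t; rewrite in_itv/= => /andP[t0 _]; rewrite derive1E derive_val.
  (* Between [y + t h] and [y] the hypothesis is [t] times the wanted sign condition on the
     derivative, and [t > 0] cancels. *)
  have := gL (y + t *: h) y; rewrite addrAC subrr add0r sqnZ dotvZr expr2.
  by rewrite (_ : L * _ = t * (L * sqn h * t)) ?ler_pM2l// ?dotvE; [lra|ring].
- apply: derivable_within_continuous => t _; exact: ex_derive.
Qed.

Lemma smooth_tangent_bounds L f : smooth L f -> exists g, tangent_bounds (- L) L f g.
Proof.
move=> [g [fg gL]].
have mono u v : dotv u v <= enorm u * enorm v by exact: dotv_le_enorm.
have mon x y : dotv (g x - g y) (x - y) <= L * sqn (x - y).
  apply: (le_trans (mono _ _)); rewrite -sqr_enorm expr2 mulrA.
  by rewrite ler_wpM2r ?enorm_ge0.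
exists g => y h; rewrite (descent_lemma fg mon) andbT.
have monN x z : dotv (- g x - - g z) (x - z) <= L * sqn (x - z).
  rewrite -opprD dotvNl -dotvNr; apply: (le_trans (mono _ _)).
  by rewrite enormN -sqr_enorm expr2 mulrA ler_wpM2r ?enorm_ge0.
have := descent_lemma (is_gradientN fg) monN y h.
by rewrite dotvNl; lra.
Qed.

(** Near [x], [f] is squeezed between two quadratics that both take the value [f x] at [x]. *)
Lemma tangent_bounds_continuous m M f g : tangent_bounds m M f g ->
  forall x : 'rV[R]_d, f @ x --> f x.
Proof.
move=> fg x.
have lim C : (fun y : 'rV[R]_d => f x + (dotv (g x) (y - x) + C / 2 * sqn (y - x))) @ x --> f x.
  have cvgcoord i : (fun y : 'rV[R]_d => (y - x) 0 i) @ x --> ((x - x) 0 i : R).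
    have -> : (fun y : 'rV[R]_d => (y - x) 0 i) = (fun y => y 0 i - x 0 i).
      by apply/funext => y; rewrite !mxE.
    have -> : (x - x) 0 i = x 0 i - x 0 i by rewrite !mxE.
    by apply: (@cvgB _ _ _ (nbhs x)); [exact: coord_continuous|exact: cvg_cst].
  have cvgdot (a b : 'rV[R]_d -> 'rV[R]_d) : (forall i, (fun y => a y 0 i) @ x --> a x 0 i) ->
      (forall i, (fun y => b y 0 i) @ x --> b x 0 i) ->
      (fun y => dotv (a y) (b y)) @ x --> dotv (a x) (b x).
    move=> ca cb; rewrite /dotv; apply: (@cvg_big R _ +%R 0 _ (@add_continuous R) _ (nbhs x)) => i _.
    exact: (@cvgM _ _ (nbhs x)).
  have {2}-> : f x = f x + (dotv (g x) (x - x) + C / 2 * sqn (x - x)).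
    by rewrite /sqn subrr !dotv0r mulr0 !addr0.
  apply: (@cvgD _ _ _ (nbhs x)); first exact: (@cvg_cst _ _ _ (nbhs x)).
  apply: (@cvgD _ _ _ (nbhs x)).
    apply: (cvgdot (fun=> g x) (fun y => y - x)) => [i|]; last exact: cvgcoord.
    exact: (@cvg_cst _ _ _ (nbhs x)).
  apply: (@cvgM _ _ (nbhs x)); first exact: (@cvg_cst _ _ _ (nbhs x)).
  exact: (cvgdot (fun y => y - x) (fun y => y - x)).
apply: (squeeze_cvgr _ (lim m) (lim M)).
near=> y; have := fg x (y - x); rewrite [x + _]addrC subrK; lra.
Unshelve. all: by end_near.
Qed.

Lemma tangent_bounds_min m M f g : 0 < m -> tangent_bounds m M f g ->
  exists z, forall y, f z <= f y.
Proof.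
move=> m0 fg.
(* Once [|y| >= r], the term [m / 2 * |y|^2] dominates the linear term at 0, so [f y >= f 0]; a
   minimizer over the compact box of half-width [r] is then global. *)
pose r := 2 / m * enorm (g 0).
have r0 : 0 <= r by rewrite mulr_ge0 ?enorm_ge0// divr_ge0// ltW.
pose A := [set y : 'rV[R]_d | forall i, `[- r, r]%classic (y 0 i)]%classic.
have A0 : A 0 by move=> i /=; rewrite mxE in_itv/= r0 oppr_le0 r0.
have [|||c cA cmin] := @EVT_min_rV R d f A.
- by exists 0.
- by apply: (@rV_compact R d (fun=> `[- r, r]%classic)) => i; exact: segment_compact.
- by apply: continuous_subspaceT; exact: tangent_bounds_continuous fg.
exists c => y; have [yA|yA] := pselect (A y); first by apply: cmin; rewrite inE.
apply: (le_trans (cmin 0 _)); first by rewrite inE.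
have [i ri] : exists i, r < `|y 0 i|.
  apply: contrapT => yr; apply: yA => i /=; rewrite in_itv/= -ler_norml leNgt.
  by apply/negP => ?; apply: yr; exists i.
have ry : r ^+ 2 <= sqn y.
  apply: le_trans (sqr_coord_le y i); rewrite -(real_normK (num_real (y 0 i))).
  by rewrite ler_pXn2r ?nnegrE// ltW.
have := fg 0 y; rewrite add0r => /andP[lb _].
(* The weight [2 / m] spends half of the quadratic term, leaving [m / 4 * |y|^2] to offset
   [|g 0|^2 / m]. *)
have := dotv_young (- g 0) y (divr_gt0 (ltr0n _ 2) m0).
rewrite sqnN dotvNl -sqr_enorm.
have e : m / 4 * r ^+ 2 = 2 / m / 2 * enorm (g 0) ^+ 2.
  by rewrite /r; field; rewrite gt_eqF.
have -> : (2 * (2 / m))^-1 = m / 4 by field; rewrite gt_eqF.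
have : m / 4 * r ^+ 2 <= m / 4 * sqn y by rewrite ler_wpM2l//; lra.
rewrite e; lra.
Qed.

End TangentBounds.

(** * First-order conditions and operations preserving tangent bounds *)

Section Moreau.
Set Implicit Arguments.
Unset Strict Implicit.
Local Open Scope classical_set_scope.
Local Open Scope ring_scope.
Context {R : realType} {d : nat}.
Implicit Types (u v x y z h : 'rV[R]_d) (f : 'rV[R]_d -> R) (g : 'rV[R]_d -> 'rV[R]_d).

Lemma little_o_eq0 (M : R) v : (forall e, 0 < e -> exists2 del, 0 < del &
  forall h, enorm h < del -> dotv v h <= e * enorm h + M / 2 * sqn h) -> v = 0.
Proof.
move=> vo; apply: contrapT => v0.
have n0 : 0 < enorm v.
  rewrite lt_def enorm_ge0 andbT; apply/eqP => e0; apply: v0; apply: sqn_eq0.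
  by rewrite -sqr_enorm e0 expr0n.
have [del del0 H] := vo (enorm v / 4) (divr_gt0 n0 (ltr0n _ 4)).
have M0 : 0 < 2 * (`|M| + 1) by have := normr_ge0 M; lra.
(* The first bound keeps [|t v|] below [del]; the second makes the quadratic term at most
   [t |v|^2 / 4]. The linear error is also [t |v|^2 / 4], which contradicts [<v, t v> = t |v|^2]. *)
pose t := Num.min (del / (2 * enorm v)) (2 * (`|M| + 1))^-1.
have t0 : 0 < t by rewrite lt_min invr_gt0 M0 divr_gt0// mulr_gt0.
have Mt : M * t <= 2^-1.
  apply: (@le_trans _ _ ((`|M| + 1) * t)).
    by rewrite ler_wpM2r ?(ltW t0)//; have := ler_norm M; lra.
  have : t <= (2 * (`|M| + 1))^-1 by rewrite ge_min lexx orbT.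
  rewrite -(ler_pM2l M0) mulfV ?gt_eqF//; lra.
have : t <= del / (2 * enorm v) by rewrite ge_min lexx.
rewrite ler_pdivlMr ?mulr_gt0// => tdel.
have := H (t *: v); rewrite enormZ gtr0_norm// => /(_ _)/wrap[]; first lra.
rewrite dotvZr sqnZ -/(sqn v) -sqr_enorm.
have p0 : 0 < t * enorm v ^+ 2 by rewrite mulr_gt0// exprn_gt0.
have := ler_wpM2r (ltW p0) Mt.
rewrite (_ : M / 2 * _ = M * t * (t * enorm v ^+ 2) / 2); last by ring.
rewrite (_ : _ / 4 * _ = t * enorm v ^+ 2 / 4); last by ring.
lra.
Qed.

Lemma tangent_bounds_gradient m M f g gf x :
  tangent_bounds m M f g -> is_gradient f gf -> gf x = g x.
Proof.
move=> fg fgf; apply/eqP; rewrite -subr_eq0; apply/eqP.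
apply: (@little_o_eq0 M) => e /(fgf x)[del del0 H]; exists del => // h /H.
rewrite ler_norml !dotvE; have := fg x h; lra.
Qed.

Lemma tangent_bounds_critical m M f g z :
  tangent_bounds m M f g -> (forall y, f z <= f y) -> g z = 0.
Proof.
move=> fg fz; rewrite -[g z]opprK; apply/eqP; rewrite oppr_eq0; apply/eqP.
apply: (@little_o_eq0 M) => e e0; exists 1 => // h _.
have := mulr_ge0 (ltW e0) (enorm_ge0 h).
rewrite dotvNl; have := fz (z + h); have := fg z h; lra.
Qed.

(** Add the lower bounds from [z] to [y] and from [y] to [z], where the slope at the minimizer [z]
    vanishes. *)
Lemma tangent_bounds_strong_monotone m M f g y z : tangent_bounds m M f g ->
  (forall y, f z <= f y) -> m * sqn (y - z) <= dotv (g y) (y - z).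
Proof.
move=> fg fz; have := fg z (y - z); have := fg y (z - y).
rewrite (tangent_bounds_critical fg fz) [dotv 0 _]dotvC dotv0r !subrKC -(opprB y z) sqnN dotvNr; lra.
Qed.

Lemma tangent_bounds_quadratic m M f g c w : tangent_bounds m M f g ->
  tangent_bounds (m + c) (M + c) (fun y => f y + c / 2 * sqn (y - w))
    (fun y => g y + c *: (y - w)).
Proof.
move=> fg y h; have := fg y h.
rewrite -(opprB w) -[y + h - w](opprB w) !sqnN [- (y + h)]opprD [w + (_ + _)]addrA [sqn (w - y - h)]sqnB.
rewrite dotvDl dotvZl dotvNl; lra.
Qed.

Lemma tangent_bounds_mean N m M (f : 'I_N -> 'rV[R]_d -> R)
    (g : 'I_N -> 'rV[R]_d -> 'rV[R]_d) : (0 < N)%N ->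
  (forall j, tangent_bounds m M (f j) (g j)) ->
  tangent_bounds m M (fun y => N%:R^-1 * \sum_(j < N) f j y)
    (fun y => N%:R^-1 *: \sum_(j < N) g j y).
Proof.
move=> N0 fg y h.
have Np : 0 < N%:R :> R by rewrite ltr0n.
have mean (c : R) : c = N%:R^-1 * \sum_(j < N) c.
  by rewrite sumr_const card_ord -[c *+ N]mulr_natl mulKf ?gt_eqF.
rewrite dotvZl dotv_suml -mulrBr -sumrB (mean (m / 2 * _)) (mean (M / 2 * _)).
rewrite -!mulrDr -!big_split /= !ler_pM2l ?invr_gt0//.
by apply/andP; split; apply: ler_sum => j _; have /andP[] := fg j y h.
Qed.

(** * Proximal points and Moreau envelopes *)

Lemma inf_range_min (T : Type) (F : T -> R) (t : T) : (forall s, F t <= F s) -> inf (range F) = F t.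
Proof.
move=> Ft; apply/le_anti/andP; split.
  by apply: ge_inf; [exists (F t) => _ [s _ <-]|exists t].
by apply: lb_le_inf; [exists (F t), t|move=> _ [s _ <-]].
Qed.

(** The proximal objective has modulus [m + lam > 0], so it attains its minimum and [xget] returns a
    minimizer instead of its default 0. *)
Lemma prox_min m M f g lam w : 0 < m + lam -> tangent_bounds m M f g ->
  forall y, f (prox f lam w) + lam / 2 * sqn (prox f lam w - w) <= f y + lam / 2 * sqn (y - w).
Proof.
move=> mlam /(tangent_bounds_quadratic lam w)/(tangent_bounds_min mlam)[z zmin].
by apply: (xgetPex 0 (P := prox_set f lam w)); exists z.
Qed.

Lemma moreau_prox m M f g lam w : 0 < m + lam -> tangent_bounds m M f g ->
  moreau f lam w = f (prox f lam w) + lam / 2 * sqn (prox f lam w - w).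
Proof. by move=> mlam fg; apply: inf_range_min; exact: prox_min mlam fg. Qed.

Lemma moreau_le m M f g lam w y : 0 < m + lam -> tangent_bounds m M f g ->
  moreau f lam w <= f y + lam / 2 * sqn (y - w).
Proof. by move=> mlam fg; rewrite (moreau_prox _ mlam fg); exact: prox_min mlam fg y. Qed.

Lemma prox_critical m M f g lam w : 0 < m + lam -> tangent_bounds m M f g ->
  g (prox f lam w) = lam *: (w - prox f lam w).
Proof.
move=> mlam fg; rewrite -(opprB (prox f lam w)) scalerN; apply/eqP; rewrite -addr_eq0; apply/eqP.
exact: (tangent_bounds_critical (tangent_bounds_quadratic lam w fg)) (prox_min w mlam fg).
Qed.

Lemma moreau_tangent_bounds L M f g lam : 0 < lam -> 2 * L < lam -> tangent_bounds (- L) M f g ->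
  tangent_bounds (- lam) lam (moreau f lam) (fun w => lam *: (w - prox f lam w)).
Proof.
move=> lam0 Llam fg w h.
have mlam : 0 < - L + lam by lra.
set th := prox f lam w; set th' := prox f lam (w + h); set a := w - th; set u := th' - th.
have Mw : moreau f lam w = f th + lam / 2 * sqn a.
  by rewrite (moreau_prox _ mlam fg) -/th -sqnN opprB.
have Mw' : moreau f lam (w + h) = f th' + lam / 2 * sqn (u - (a + h)).
  rewrite (moreau_prox _ mlam fg) -/th'; congr (_ + _ / 2 * sqn _).
  by apply/rowP => i; rewrite !mxE; ring.
(* Upper bound: [th], optimal at [w], is a competitor at [w + h]. *)
have := moreau_le (w + h) th mlam fg.
rewrite -sqnN opprB addrAC -/a.
(* Lower bound: compare [f th'] with the tangent of [f] at [th], whose slope is [lam *: a] by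
   optimality. *)
have := fg th u; rewrite (prox_critical _ mlam fg) -/th -/a /u subrKC -/u.
rewrite Mw' Mw !dotvZl sqnB => /andP[lb _].
rewrite sqnD.
(* Completing the square: [lam/4 * |u - 2 h|^2 >= 0] absorbs the weak convexity as [2 L <= lam]. *)
have := mulr_ge0 (ltW lam0) (sqn_ge0 (u - 2 *: h)).
rewrite sqnB sqnZ !dotvZr dotvDr (dotvC u a).
have : 0 <= (lam - 2 * L) * sqn u by rewrite mulr_ge0 ?sqn_ge0//; lra.
rewrite expr2; lra.
Qed.

(** * Gradient descent with errors *)

Lemma inexact_gradient_step m M f g eta y e : tangent_bounds m M f g ->
  0 < M -> 0 < eta -> eta <= M^-1 ->
  f (y - eta *: (g y + e)) <= f y - eta / 2 * (sqn (g y) - sqn e).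
Proof.
move=> fg M0 eta0 etaM; have := fg y (- (eta *: (g y + e))).
rewrite dotvNr dotvZr sqnN sqnZ => /andP[_].
(* This reduces the quadratic term to [eta / 2 * |g y + e|^2]; expanding it cancels the cross term
   [<g y, e>]. *)
have : M * eta <= 1 by rewrite -ler_pdivlMl ?mulr1.
rewrite -subr_ge0 => /mulr_ge0/(_ (mulr_ge0 (ltW eta0) (sqn_ge0 (g y + e)))).
rewrite sqnD dotvDr -/(sqn (g y)) expr2; lra.
Qed.

Lemma inexact_gradient_descent m M f g eta (w e : nat -> 'rV[R]_d) (S E : R) K :
  tangent_bounds m M f g -> 0 < M -> 0 < eta -> eta <= M^-1 ->
  (forall k, (k < K)%N -> w k.+1 = w k - eta *: (g (w k) + e k)) ->
  (forall k, (k < K)%N -> S <= sqn (g (w k))) ->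
  (forall k, (k < K)%N -> sqn (e k) <= E) ->
  f (w K) <= f (w 0%N) - K%:R * (eta / 2 * (S - E)).
Proof.
move=> fg M0 eta0 etaM; elim: K => [|K IH] wS Sg eE; first by rewrite mul0r subr0.
have := IH (fun k kK => wS k (ltnW kK)) (fun k kK => Sg k (ltnW kK))
  (fun k kK => eE k (ltnW kK)).
have := inexact_gradient_step (w K) (e K) fg M0 eta0 etaM.
rewrite -wS// -[K.+1%:R]natr1.
have : eta / 2 * (S - E) <= eta / 2 * (sqn (g (w K)) - sqn (e K)).
  by rewrite ler_wpM2l ?lerB ?Sg ?eE//; lra.
lra.
Qed.

End Moreau.

(** * Accuracy of the best inner iterate *)

Theorem mainTheorem6 (R : realType) (d N K : nat)
  (f : 'I_N -> 'rV[R]_d -> R) (Lf lam gam eta : R)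
  (x : 'rV[R]_d) (w : nat -> 'rV[R]_d) (theta : nat -> 'I_N -> 'rV[R]_d)
  (delta : 'I_N -> R) :
  (0 < N)%N -> (0 < K)%N -> 0 < lam -> 4 * Lf < 2 * lam -> 2 * lam < gam ->
  (forall j, smooth Lf (f j)) ->
  0 < eta -> eta <= (lam + gam)^-1 ->
  w 0%N = x ->
  (forall k, (k < K)%N ->
     w k.+1 = (1 - eta * (lam + gam)) *: w k + (eta * gam) *: x
              + (eta * lam) *: ((N%:R)^-1 *: \sum_(j < N) theta k j)) ->
  (forall k j, (k < K)%N -> sqn (prox (f j) lam (w k) - theta k j) <= delta j) ->
  let F := fun y => (N%:R)^-1 * \sum_(j < N) moreau (f j) lam y in
  let p := fun y => F y + gam / 2 * sqn (y - x) in
  forall gp : 'rV[R]_d -> 'rV[R]_d, is_gradient p gp ->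
  forall kstar, (kstar < K)%N ->
  (forall k, (k < K)%N -> sqn (gp (w kstar)) <= sqn (gp (w k))) ->
  sqn (w kstar - prox F gam x)
    <= ((gam - lam) ^+ 2)^-1 *
       (2 / (K%:R * eta) * (F x - moreau F gam x)
        + lam ^+ 2 * ((N%:R)^-1 * \sum_(j < N) delta j)).
Proof.
move=> N0 K0 lam0 Lflam lamgam fL eta0 etaM w0 wS thdelta F p gp pgp kstar kK kmin.
have Np : 0 < N%:R :> R by rewrite ltr0n.
have Kp : 0 < K%:R :> R by rewrite ltr0n.
have Fb : tangent_bounds (- lam) lam F
    (fun y => N%:R^-1 *: \sum_(j < N) lam *: (y - prox (f j) lam y)).
  apply: tangent_bounds_mean => // j; have [g fg] := smooth_tangent_bounds (fL j).
  by apply: moreau_tangent_bounds fg => //; lra.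
set gF := (fun y => _) in Fb.
have pb : tangent_bounds (- lam + gam) (lam + gam) p (fun y => gF y + gam *: (y - x)).
  exact: tangent_bounds_quadratic.
set g := (fun y => _) in pb.
(* The given gradient [gp] must agree with the explicit slope of [p]. *)
have gpE y : gp y = g y := tangent_bounds_gradient y pb pgp.
have mgam : 0 < - lam + gam by lra.
have Mgam : 0 < lam + gam by lra.
set z := prox F gam x; set S := sqn (gp (w kstar)).
have S_ge : (gam - lam) ^+ 2 * sqn (w kstar - z) <= S.
  rewrite [gam - lam]addrC; apply: sqn_le_dotv => //; rewrite gpE.
  exact: tangent_bounds_strong_monotone pb (prox_min x mgam Fb).
pose e k := N%:R^-1 *: \sum_(j < N) lam *: (prox (f j) lam (w k) - theta k j).
set E := lam ^+ 2 * _.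
have eE k : (k < K)%N -> sqn (e k) <= E.
  move=> kK'; apply: (le_trans (sqn_mean_le _ N0)).
  rewrite /E mulrCA ler_pM2l ?invr_gt0// mulr_sumr; apply: ler_sum => j _.
  by rewrite sqnZ ler_wpM2l ?sqr_ge0// thdelta.
(* The proximal points in [g (w k)] and [e k] cancel, leaving only the mean of the [theta k j]. *)
have wg k : (k < K)%N -> w k.+1 = w k - eta *: (g (w k) + e k).
  move=> /wS ->; rewrite /g /gF /e -!scaler_sumr !sumrB sumr_const card_ord.
  apply/rowP => i; rewrite !mxE mulmxnE; field.
  by rewrite gt_eqF.
have Sg k : (k < K)%N -> S <= sqn (g (w k)) by rewrite -gpE; exact: kmin.
have := inexact_gradient_descent pb Mgam eta0 etaM wg Sg eE.
(* The envelope lies below [p (w K)], so the total decrease is at most [F x - moreau F gam x]. *)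
have := moreau_le x (w K) mgam Fb; rewrite -/(p _).
have -> : p (w 0%N) = F x by rewrite w0 /p subrr /sqn dotv0r mulr0 addr0.
move=> mK fK.
rewrite mulrC ler_pdivlMr ?exprn_gt0//; last by lra.
rewrite mulrC; apply: (le_trans S_ge); rewrite -lerBlDr.
rewrite mulrAC ler_pdivlMr ?mulr_gt0//; lra.
Qed.
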